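(* Consider the push-sum algorithm $x(t+1)=W(t)x(t)$, $y(t+1)=W(t)y(t)$, $t\ge 0$, with $x(0)\in\mathbb{R}^n$ and $y(0)=\mathbf{1}_n$, where $\{W(t)\}_{t\ge 0}$ is the random sequence of column-stochastic push-sum matrices associated with a sequence of random directed graphs with self-loops at every node. Suppose that $\{W(t)\}$ has the directed infinite flow property almost surely, and that the sequence $\{\ell_q\}$ associated with $\{W(t)\}$ satisfies $$\sum_{q=1}^\infty \frac{1}{n^{\ell_q}}=\infty\quad\text{almost surely.}$$ If there exists $\delta>0$ such that, almost surely, for any $t\ge 0$ there is $t'\ge t$ such that $y_i(t')\ge\delta$ for all $i\in[n]$, then, for all $i\in[n]$, $$\lim_{t\to\infty}\left|z_i(t+1)-\bar{x}\right|=0\quad\text{almost surely.}$$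
   Context: Let $n\ge 2$, $[n]=\{1,\dots,n\}$; time indices $t$ range over non-negative integers. $\mathbf{1}_n\in\mathbb{R}^n$ is the all-ones vector. Push-sum matrices: on a probability space $(\Omega,\mathcal{B},\mu)$, $\{\mathcal{G}(t)\}_{t\ge 0}$ is a sequence of random directed graphs on nodes $v_1,\dots,v_n$, each containing a self-loop at every node for all $t$. Let $d^{\mathrm{out}}_j(t)$ be the number of out-neighbors of $v_j$ in $\mathcal{G}(t)$ (including itself). The random matrix $W(t)$ is given by $W_{ij}(t)=1/d^{\mathrm{out}}_j(t)$ if $(v_j,v_i)$ is an edge of $\mathcal{G}(t)$, and $W_{ij}(t)=0$ otherwise; it is column-stochastic (each column sums to 1) with positive diagonal. No independence or stationarity is assumed. Push-sum: $x(0)$ is the vector of initial states, $\bar{x}=\frac1n\sum_{i=1}^n x_i(0)$, and $z_i(t+1)=x_i(t+1)/y_i(t+1)$. For a non-negative $n\times n$ matrix $A$ and $S\subset[n]$ with complement $\bar S$, $A_{S\bar S}=\sum_{i\in S,j\in\bar S}A_{ij}$. A subset is non-trivial if it is neither $\emptyset$ nor $[n]$. A sequence $\{A(t)\}_{t\ge0}$ of non-negative matrices has the directed infinite flow property if $\sum_{t=0}^\infty A_{S\bar S}(t)=\infty$ for every non-trivial $S\subset[n]$. The following are defined along each sample path with $A(t)=W(t)$: $k_0=0$, and for $q\ge1$, $k_q$ is the smallest integer $t'>k_{q-1}$ such that $\sum_{t=k_{q-1}}^{t'-1}A_{S\bar S}(t)>0$ for every non-trivial $S\subset[n]$. For $q\ge1$,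 $\ell_q=k_{qn}-k_{(q-1)n}$. *)

(* Defs.v *)
From HB Require Import structures.
From mathcomp Require Import all_boot all_order all_algebra.
From mathcomp Require Import all_classical all_reals all_analysis.
Set Implicit Arguments.
Unset Strict Implicit.
Unset Printing Implicit Defensive.
Import Order.TTheory GRing.Theory Num.Theory.
Import numFieldNormedType.Exports.
Local Open Scope classical_set_scope.
Local Open Scope ring_scope.

(* A directed graph on the nodes 'I_n is a relation [g], where [g j i] means
   that there is an edge from [j] to [i]. *)
Definition outdeg (n : nat) (g : rel 'I_n) (j : 'I_n) : nat := #|[set i | g j i]%SET|.

Definition push_sum_matrix (R : realType) (n : nat) (g : rel 'I_n) : 'M[R]_n :=
  \matrix_(i < n, j < n) (if g j i then (outdeg g j)%:R^-1 else 0).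

(* Measurability with respect to the discrete sigma-algebra on the finite set
   of graphs amounts to measurability of each edge event. *)
Definition random_digraph (d : measure_display) (T : measurableType d)
    (n : nat) (G : T -> rel 'I_n) : Prop :=
  forall i j : 'I_n, measurable [set w | G w i j].

Fixpoint trajectory (R : realType) (n : nat) (A : nat -> 'M[R]_n)
    (v0 : 'cV[R]_n) (t : nat) : 'cV[R]_n :=
  if t is t'.+1 then A t' *m trajectory A v0 t' else v0.

Definition push_sum_x (R : realType) (n : nat) (A : nat -> 'M[R]_n)
    (x0 : 'cV[R]_n) (t : nat) (i : 'I_n) : R := trajectory A x0 t i 0.

Definition push_sum_y (R : realType) (n : nat) (A : nat -> 'M[R]_n)
    (t : nat) (i : 'I_n) : R := trajectory A (const_mx 1) t i 0.

Definition push_sum_z (R : realType) (n : nat) (A : nat -> 'M[R]_n)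
    (x0 : 'cV[R]_n) (t : nat) (i : 'I_n) : R :=
  push_sum_x A x0 t i / push_sum_y A t i.

Definition average (R : realType) (n : nat) (v : 'cV[R]_n) : R :=
  n%:R^-1 * \sum_(i < n) v i 0.

Definition nontrivial (n : nat) (S : {set 'I_n}) : bool :=
  (S != finset.set0) && (S != finset.setT).

Definition cut (R : realType) (n : nat) (A : 'M[R]_n) (S : {set 'I_n}) : R :=
  \sum_(i in S) \sum_(j in (~: S)%SET) A i j.

Definition directed_infinite_flow (R : realType) (n : nat)
    (A : nat -> 'M[R]_n) : Prop :=
  forall S : {set 'I_n}, nontrivial S ->
    (\sum_(0 <= t <oo) (cut (A t) S)%:E = +oo)%E.

Definition positive_flow (R : realType) (n : nat) (A : nat -> 'M[R]_n)
    (s t' : nat) : bool :=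
  [forall S : {set 'I_n}, nontrivial S ==> (0 < \sum_(s <= t < t') cut (A t) S)].

(* The value 0 is a dummy, used when no admissible time exists; this never
   happens under the directed infinite flow property. *)
Definition next_flow_time (R : realType) (n : nat) (A : nat -> 'M[R]_n)
    (s : nat) : nat :=
  match pselect (exists t', (s < t')%N && positive_flow A s t') with
  | left ex => ex_minn ex
  | right _ => 0%N
  end.

Fixpoint flow_time (R : realType) (n : nat) (A : nat -> 'M[R]_n)
    (q : nat) : nat :=
  if q is q'.+1 then next_flow_time A (flow_time A q') else 0%N.

(* Meaningful for q >= 1. *)
Definition flow_gap (R : realType) (n : nat) (A : nat -> 'M[R]_n)
    (q : nat) : nat :=
  (flow_time A (q * n) - flow_time A (q.-1 * n))%N.

(* Main.v *)
Require Import Defs.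
From HB Require Import structures.
From mathcomp Require Import all_boot all_order all_algebra.
From mathcomp Require Import all_classical all_reals all_analysis.
From mathcomp Require Import lra.
Import Order.TTheory GRing.Theory Num.Theory.
Import numFieldNormedType.Exports.
Local Open Scope classical_set_scope.
Local Open Scope ring_scope.

(** The argument is pathwise. Write [a] for the average of the initial states
    and [u(t) = x(t) - a y(t)], so that [z_i(t) - a = u_i(t) / y_i(t)]. Both [u]
    and [y] evolve by the same column-stochastic matrices, which preserve total
    mass: the entries of [u(t)] always sum to 0, and those of [y(t)] to [n].

    The quantity that decreases is the least [e] with [|u_j| <= e y_j] for all
    [j]. Let [M] be column-stochastic with all entries at least [c]. The vector
    [u + e y] is non-negative of total mass [e (sum y)], so each entry of
    [M (u + e y)] is at least [c e (sum y)], which is at least [c e (M y)_i].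
    Hence [(M u)_i >= - (1 - c) e (M y)_i], and by symmetry [e] shrinks by the
    factor [1 - c] ([column_stochastic_deviation]). Measuring the error relative
    to [y] makes the rate depend on [M] alone: small values of [y] do no harm.

    The product of the matrices over the [q]-th group of [n] flow windows has all
    its entries at least [n^(- l_q)] ([transition_flow_ge]). Indeed the set of
    nodes that can be reached from a given one gains a node in every window until
    it is everything, and a positive entry of a product of [k] matrices whose
    positive entries are at least [1/n] is at least [n^(- k)].

    So [|z_i(t) - a|] is at most a constant times the product of the
    [1 - n^(- l_p)] for [p <= q], once [t] is past the [q]-th group; this product
    tends to 0 because the series of the [n^(- l_p)] diverges
    ([push_sum_consensus]). *)

(** * Column-stochastic matrices *)

Definition column_stochastic {R : realType} {n : nat} (M : 'M[R]_n) : Prop :=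
  (forall i j, 0 <= M i j) /\ (forall j, \sum_i M i j = 1).

Lemma column_stochastic_le1 {R : realType} {n : nat} {M : 'M[R]_n} :
  column_stochastic M -> forall i j, M i j <= 1.
Proof.
by move=> [M0 M1] i j; rewrite -(M1 j) (bigD1 i) //= lerDl sumr_ge0.
Qed.

Lemma sum_column_stochastic_mulmx {R : realType} {n : nat} {M : 'M[R]_n}
    (v : 'cV[R]_n) :
  column_stochastic M -> \sum_i (M *m v) i 0 = \sum_i v i 0.
Proof.
move=> [_ M1]; under eq_bigr do rewrite mxE.
by rewrite exchange_big; apply: eq_bigr => j _; rewrite -mulr_suml M1 mul1r.
Qed.

Lemma column_stochastic1 {R : realType} {n : nat} :
  column_stochastic (1%:M : 'M[R]_n).
Proof.
split=> [i j|j]; first by rewrite mxE ler0n.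
rewrite (bigD1 j) //= big1 ?addr0 ?mxE ?eqxx // => i ij.
by rewrite mxE (negbTE ij).
Qed.

Lemma column_stochasticM {R : realType} {n : nat} {M N : 'M[R]_n} :
  column_stochastic M -> column_stochastic N -> column_stochastic (M *m N).
Proof.
move=> hM [N0 N1]; split=> [i j|j].
  by rewrite mxE sumr_ge0 // => k _; rewrite mulr_ge0 //; case: hM.
under eq_bigr do rewrite mxE.
rewrite exchange_big -(N1 j); apply: eq_bigr => k _ /=.
by rewrite -mulr_suml hM.2 mul1r.
Qed.

(** The entries of [u] sum to 0, so [u + e y] and [- u + e y] are non-negative
    with the same mass as [e y], and the lower bound [c] on the entries of [M]
    makes every node receive at least the fraction [c] of this mass. With
    [c = 0] this says that the relative error never increases. *)
Lemma column_stochastic_deviation {R : realType} {n : nat} {M : 'M[R]_n}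
    {c e : R} {u y : 'cV[R]_n} :
  column_stochastic M -> 0 <= c -> (forall i j, c <= M i j) -> 0 <= e ->
  (forall j, 0 <= y j 0) -> \sum_j u j 0 = 0 ->
  (forall j, `|u j 0| <= e * y j 0) ->
  forall i, `|(M *m u) i 0| <= (1 - c) * e * (M *m y) i 0.
Proof.
move=> hM c0 cM e0 y0.
have one_sided (v : 'cV[R]_n) i : \sum_j v j 0 = 0 ->
    (forall j, - (e * y j 0) <= v j 0) ->
    - ((1 - c) * e * (M *m y) i 0) <= (M *m v) i 0.
  move=> v0 hv.
  (* No node holds more than the total mass of [y], which lets the gain
     [c * e * sum y] be expressed relative to [(M *m y) i]. *)
  have mass_ge : (M *m y) i 0 <= \sum_j y j 0.
    rewrite mxE ler_sum // => j _.
    by rewrite ler_piMl // (column_stochastic_le1 hM).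
  have : \sum_j c * (v j 0 + e * y j 0) <= \sum_j M i j * (v j 0 + e * y j 0).
    rewrite ler_sum // => j _; rewrite ler_wpM2r //.
    by have := hv j; lra.
  rewrite -mulr_sumr big_split /= v0 add0r -mulr_sumr.
  under [X in _ <= X]eq_bigr do rewrite mulrDr mulrCA.
  rewrite big_split /= -mulr_sumr.
  have -> : \sum_j M i j * v j 0 = (M *m v) i 0 by rewrite mxE.
  have -> : \sum_j M i j * y j 0 = (M *m y) i 0 by rewrite mxE.
  have : c * (e * (M *m y) i 0) <= c * (e * \sum_j y j 0).
    by rewrite ler_wpM2l // ler_wpM2l.
  by nra.
move=> u0 hu i; rewrite ler_norml; apply/andP; split.
  by apply: one_sided => // j; have := hu j; rewrite ler_norml => /andP[].
rewrite -lerN2; have -> : - (M *m u) i 0 = (M *m - u) i 0.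
  by rewrite mulmxN [RHS]mxE.
apply: one_sided => [|j].
  under eq_bigr do rewrite mxE.
  by rewrite sumrN u0 oppr0.
by rewrite mxE lerN2; have := hu j; rewrite ler_norml => /andP[].
Qed.

(** * Products of matrices along a trajectory *)

Lemma trajectory_lin {R : realType} {n : nat} (A : nat -> 'M[R]_n)
    (v w : 'cV[R]_n) (a : R) t :
  trajectory A (v - a *: w) t = trajectory A v t - a *: trajectory A w t.
Proof. by elim: t => //= t ->; rewrite mulmxBr -scalemxAr. Qed.

(** The product [A (s + k - 1) ... A s]. It is indexed by the duration [k]
    because lower bounds on its entries are powers with exponent [k]. *)
Fixpoint transition {R : realType} {n : nat} (A : nat -> 'M[R]_n)
    (s k : nat) : 'M[R]_n :=
  if k is k'.+1 then A (s + k')%N *m transition A s k' else 1%:M.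

Lemma trajectory_transition {R : realType} {n : nat} (A : nat -> 'M[R]_n)
    (v : 'cV[R]_n) s k :
  trajectory A v (s + k) = transition A s k *m trajectory A v s.
Proof.
elim: k => [|k IH]; first by rewrite addn0 /= mul1mx.
by rewrite addnS /= IH mulmxA.
Qed.

Lemma column_stochastic_transition {R : realType} {n : nat}
    {A : nat -> 'M[R]_n} s k :
  (forall t, column_stochastic (A t)) -> column_stochastic (transition A s k).
Proof.
move=> hA; elim: k => [|k IH] /=; first exact: column_stochastic1.
exact: column_stochasticM.
Qed.

Lemma sum_trajectory {R : realType} {n : nat} {A : nat -> 'M[R]_n}
    (v : 'cV[R]_n) t :
  (forall t, column_stochastic (A t)) ->
  \sum_i trajectory A v t i 0 = \sum_i v i 0.
Proof.
by move=> hA; elim: t => //= t <-; rewrite sum_column_stochastic_mulmx.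
Qed.

Lemma trajectory_gt0 {R : realType} {n : nat} {A : nat -> 'M[R]_n}
    {v : 'cV[R]_n} :
  (forall t, column_stochastic (A t)) -> (forall t i, 0 < A t i i) ->
  (forall i, 0 < v i 0) -> forall t i, 0 < trajectory A v t i 0.
Proof.
move=> hA dA v0; elim=> //= t IH i.
rewrite mxE (bigD1 i) //= ltr_wpDr ?mulr_gt0 //.
by rewrite sumr_ge0 // => j _; rewrite mulr_ge0 ?(hA t).1 // ltW.
Qed.

Lemma psumr_gt0P {R : realType} {I : eqType} {r : seq I} {P : pred I}
    {F : I -> R} :
  (forall i, P i -> 0 <= F i) -> 0 < \sum_(i <- r | P i) F i ->
  exists i, [/\ i \in r, P i & 0 < F i].
Proof.
move=> F0 /lt0r_neq0; rewrite psumr_neq0 // => /hasP[i ir /andP[Pi Fi]].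
by exists i.
Qed.

(** A positive entry of a product contains at least one positive path, and
    already the weight of that path is at least [b ^+ k]. *)
Lemma transition_ge {R : realType} {n : nat} {A : nat -> 'M[R]_n} {b : R} :
  (forall t, column_stochastic (A t)) ->
  0 <= b -> (forall t i j, 0 < A t i j -> b <= A t i j) ->
  forall s k i j, 0 < transition A s k i j -> b ^+ k <= transition A s k i j.
Proof.
move=> hA b0 hb s; elim=> [|k IH] i j /=.
  by rewrite mxE expr0; case: (i == j); rewrite ?ltxx.
have T0 := (column_stochastic_transition s k hA).1.
have A0 := (hA (s + k)%N).1.
rewrite mxE => /psumr_gt0P[l _|l [_ _ lpos]]; first by rewrite mulr_ge0.
have Tl : 0 < transition A s k l j.
  by rewrite lt_def T0 andbT; apply: contraTneq lpos => ->; rewrite mulr0 ltxx.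
have Al : 0 < A (s + k)%N i l.
  by rewrite lt_def A0 andbT; apply: contraTneq lpos => ->; rewrite mul0r ltxx.
rewrite exprS (bigD1 l) //=; apply: ler_wpDr.
  by rewrite sumr_ge0 // => m _; rewrite mulr_ge0.
by apply: ler_pM; rewrite ?exprn_ge0 ?hb ?IH.
Qed.

(** * Spreading over flow windows *)

Definition reached {R : realType} {n : nat} (A : nat -> 'M[R]_n)
    (s : nat) (j : 'I_n) (k : nat) : {set 'I_n} :=
  [set i | 0 < transition A s k i j]%SET.

Lemma reachedS {R : realType} {n : nat} {A : nat -> 'M[R]_n} s j k i l :
  (forall t, column_stochastic (A t)) ->
  l \in reached A s j k -> 0 < A (s + k)%N i l -> i \in reached A s j k.+1.
Proof.
move=> hA; rewrite !inE /= => Tl Al; rewrite mxE (bigD1 l) //=.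
have T0 := (column_stochastic_transition s k hA).1.
have A0 := (hA (s + k)%N).1.
by rewrite ltr_wpDr ?mulr_gt0 // sumr_ge0 // => m _; rewrite mulr_ge0.
Qed.

(** Self-loops: a node that has been reached stays reached. *)
Lemma subset_reached {R : realType} {n : nat} {A : nat -> 'M[R]_n} s j :
  (forall t, column_stochastic (A t)) -> (forall t i, 0 < A t i i) ->
  {homo reached A s j : k k' / (k <= k')%N >-> k \subset k'}.
Proof.
move=> hA dA k k' /subnKC <-; elim: (k' - k)%N => [|m IH]; first by rewrite addn0.
rewrite addnS; apply: (fintype.subset_trans IH); apply/fintype.subsetP => i hi.
exact: reachedS hi (dA _ _).
Qed.

(** As [cut M S] measures the flow into [S], the set to which the positive flow
    is applied is the complement of [reached A s j k]. Some edge enters it during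
    the window; its tail has been reached by then, so its head becomes a new
    node. *)
Lemma reached_positive_flow {R : realType} {n : nat} {A : nat -> 'M[R]_n}
    s j k k' :
  (forall t, column_stochastic (A t)) -> (forall t i, 0 < A t i i) ->
  nontrivial (reached A s j k) ->
  positive_flow A (s + k) (s + k') ->
  (#|reached A s j k| < #|reached A s j k'|)%N.
Proof.
move=> hA dA /andP[nt0 ntT] /forallP/(_ (~: reached A s j k)%SET)/implyP.
have ntC : nontrivial (~: reached A s j k)%SET.
  rewrite /nontrivial -(inj_eq (@finset.setC_inj _)) finset.setCK finset.setC0 ntT /=.
  by rewrite -(inj_eq (@finset.setC_inj _)) finset.setCK finset.setCT nt0.
move=> /(_ ntC) /psumr_gt0P[t _|t [+ _]].
  by rewrite sumr_ge0 // => i _; rewrite sumr_ge0 // => l _; case: (hA t).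
rewrite mem_index_iota => /andP[km mk'].
move=> /psumr_gt0P[i _|i [_ iC]].
  by rewrite sumr_ge0 // => l _; case: (hA t).
move=> /psumr_gt0P[l _|l [_ lC Ail]]; first by case: (hA t).
have hm : t = (s + (t - s))%N.
  by rewrite subnKC //; apply: leq_trans km; rewrite leq_addr.
move: lC iC; rewrite finset.setCK finset.in_setC => lC iC.
have km' : (k <= t - s)%N by rewrite -(leq_add2l s) -hm.
have mk : (t - s < k')%N by rewrite -(ltn_add2l s) -hm.
have ir : i \in reached A s j (t - s).+1.
  apply: (reachedS s j (t - s) i l) => //; last by rewrite -hm.
  by apply: (fintype.subsetP (subset_reached s j hA dA _ _ km')).
apply: proper_card; apply/fintype.properP; split.
  by apply: subset_reached => //; apply: leq_trans km' (ltnW mk).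
by exists i => //; apply: (fintype.subsetP (subset_reached s j hA dA _ _ mk)).
Qed.

(** * Flow times *)

Lemma nneseries_pinfty_gt {R : realType} {f : nat -> R} {m : nat} :
  (forall k, 0 <= f k) -> (\sum_(m <= k <oo) (f k)%:E = +oo)%E ->
  forall B, exists N, B < \sum_(m <= k < N) f k.
Proof.
move=> f0 foo B; apply: contrapT => /forallNP hN.
have : (\sum_(m <= k <oo) (f k)%:E <= B%:E)%E.
  apply: lime_le; first by apply: is_cvg_nneseries => k _ _; rewrite lee_fin.
  apply: nearW => N; rewrite sumEFin lee_fin leNgt; apply/negP; exact: hN.
by rewrite foo.
Qed.

Lemma cut_ge0 {R : realType} {n : nat} {M : 'M[R]_n} S :
  column_stochastic M -> 0 <= Defs.cut M S.
Proof.
by move=> [M0 _]; apply: sumr_ge0 => i _; apply: sumr_ge0 => j _.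
Qed.

(** A divergent series still diverges without its first [s] terms, so each cut
    is eventually crossed after time [s]; as there are finitely many cuts, one
    time serves for all of them. *)
Lemma positive_flow_exists {R : realType} {n : nat} {A : nat -> 'M[R]_n} s :
  (forall t, column_stochastic (A t)) -> directed_infinite_flow A ->
  exists t, (s < t)%N && positive_flow A s t.
Proof.
move=> hA hflow.
have /boolp.choice[N hN] (S : {set 'I_n}) : exists N : nat, nontrivial S ->
    (s < N)%N /\ 0 < \sum_(s <= t < N) Defs.cut (A t) S.
  have [ntS|//] := boolP (nontrivial S); last by exists 0%N.
  have cut0 t : 0 <= Defs.cut (A t) S by exact: cut_ge0.
  have [N hN] := nneseries_pinfty_gt cut0 (hflow S ntS)
    (\sum_(0 <= t < s) Defs.cut (A t) S).
  exists N => _; have sN : (s < N)%N.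
    rewrite ltnNge; apply: contraTN hN => Ns; rewrite -leNgt.
    by rewrite (big_cat_nat (leq0n N) Ns) //= lerDl sumr_ge0.
  split=> //; move: hN.
  by rewrite (big_cat_nat (leq0n s) (ltnW sN)) //= ltrDl.
exists (maxn s.+1 (\max_S N S)); rewrite leq_maxl /=.
apply/forallP => S; apply/implyP => ntS; have [sN pos] := hN S ntS.
rewrite (@big_cat_nat _ _ _ (N S)) //=; last 2 first.
- exact: ltnW.
- by apply: leq_trans (leq_maxr _ _); apply: leq_bigmax.
by rewrite ltr_wpDr // sumr_ge0 // => t _; exact: cut_ge0.
Qed.

(** Under the directed infinite flow property the dummy value in the definition
    of [next_flow_time] is never taken. *)
Lemma flow_timeS {R : realType} {n : nat} {A : nat -> 'M[R]_n} q :
  (forall t, column_stochastic (A t)) -> directed_infinite_flow A ->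
  (flow_time A q < flow_time A q.+1)%N /\
  positive_flow A (flow_time A q) (flow_time A q.+1).
Proof.
move=> hA hflow /=; rewrite /next_flow_time; case: pselect => [ex|[]].
  by case: ex_minnP => m /andP[].
exact: positive_flow_exists.
Qed.

Lemma flow_time_le {R : realType} {n : nat} {A : nat -> 'M[R]_n} :
  (forall t, column_stochastic (A t)) -> directed_infinite_flow A ->
  {homo flow_time A : q q' / (q <= q')%N}.
Proof.
move=> hA hflow; apply: homo_leq => //; first exact: leq_trans.
by move=> q; apply: ltnW; case: (flow_timeS q hA hflow).
Qed.

(** One node is reached at the start, and each window adds at least one more as
    long as some node is missing. *)
Lemma card_reached_flow_time {R : realType} {n : nat} {A : nat -> 'M[R]_n}
    r j q :
  (forall t, column_stochastic (A t)) -> (forall t i, 0 < A t i i) ->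
  directed_infinite_flow A ->
  (minn n q.+1 <=
     #|reached A (flow_time A r) j (flow_time A (r + q) - flow_time A r)|)%N.
Proof.
move=> hA dA hflow; have mono := flow_time_le hA hflow.
elim: q => [|q IH].
  rewrite addn0 subnn; apply: leq_trans (geq_minr _ _) _.
  by apply/card_gt0P; exists j; rewrite inE /= mxE eqxx ltr01.
set s := flow_time A r in IH *.
set k := (flow_time A (r + q) - s)%N in IH.
set k' := (flow_time A (r + q.+1) - s)%N.
have sk : (s + k = flow_time A (r + q))%N by rewrite subnKC // mono // leq_addr.
have sk' : (s + k' = flow_time A (r + q.+1))%N.
  by rewrite subnKC // mono // leq_addr.
have kk' : (k <= k')%N.
  by rewrite leq_sub2r // mono // addnS.
have sub := subset_leq_card (subset_reached s j hA dA _ _ kk').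
have [full|nfull] := eqVneq (reached A s j k) finset.setT.
  by apply: leq_trans sub; rewrite full cardsT card_ord geq_minl.
have nt : nontrivial (reached A s j k).
  rewrite /nontrivial nfull andbT -card_gt0; apply: leq_trans IH.
  by rewrite leq_min andbT (leq_trans _ (ltn_ord j)).
have flow : positive_flow A (s + k) (s + k').
  by rewrite sk sk' addnS; case: (flow_timeS (r + q) hA hflow).
have lt := reached_positive_flow s j k k' hA dA nt flow.
apply: leq_trans lt; apply: leq_trans (_ : (minn n q.+1).+1 <= _)%N.
  by rewrite -minnSS leq_min !geq_min leqnSn leqnn orbT.
by rewrite ltnS.
Qed.

Lemma transition_flow_ge {R : realType} {n : nat} {A : nat -> 'M[R]_n}
    {b : R} r i j :
  (forall t, column_stochastic (A t)) -> (forall t i, 0 < A t i i) ->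
  0 <= b -> (forall t i j, 0 < A t i j -> b <= A t i j) ->
  directed_infinite_flow A ->
  b ^+ (flow_time A (r + n) - flow_time A r) <=
    transition A (flow_time A r) (flow_time A (r + n) - flow_time A r) i j.
Proof.
move=> hA dA b0 hb hflow; set k := (flow_time A (r + n) - _)%N.
apply: transition_ge => //.
suff -> : 0 < transition A (flow_time A r) k i j =
    (i \in reached A (flow_time A r) j k).
  have := card_reached_flow_time r j n hA dA hflow.
  rewrite (minn_idPl (leqnSn n)) -/k => hcard.
  have /eqP -> : reached A (flow_time A r) j k == finset.setT.
    by rewrite eqEcard finset.subsetT cardsT card_ord.
  by rewrite finset.in_setT.
by rewrite inE.
Qed.

(** * Convergence *)

(** An algebraic substitute for [1 - c <= exp (- c)]: since
    [(1 - c) (1 + s + c) <= 1 + s], the product decays at least like the inverse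
    of [1 + sum c]. *)
Lemma prod_1B_mul_1D_sum_le1 {R : realType} {c : nat -> R} m N :
  (forall p, 0 <= c p <= 1) ->
  (\prod_(m <= p < N) (1 - c p)) * (1 + \sum_(m <= p < N) c p) <= 1.
Proof.
move=> c01; have [Nm|mN] := leqP N m.
  by rewrite !big_geq // addr0 mul1r.
rewrite -(subnKC (ltnW mN)); elim: (N - m)%N => [|k IH].
  by rewrite addn0 !big_geq // addr0 mul1r.
rewrite addnS !big_nat_recr ?leq_addr //=.
have /andP[c0 c1] := c01 (m + k)%N.
apply: le_trans IH; rewrite -mulrA ler_wpM2l //.
  by apply: prodr_ge0 => p _; have /andP[] := c01 p; lra.
have : 0 <= \sum_(m <= p < m + k) c p.
  by apply: sumr_ge0 => p _; have /andP[] := c01 p.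
by nra.
Qed.

(** The error relative to [y] is cut by [1 - b ^+ flow_gap A q] over the [q]-th
    group of [n] windows and never grows in between; divergence of the series
    drives the product of these factors to 0. *)
Lemma push_sum_consensus {R : realType} {n : nat} {A : nat -> 'M[R]_n} {b : R}
    (x0 : 'cV[R]_n) (i : 'I_n) :
  (forall t, column_stochastic (A t)) -> (forall t i, 0 < A t i i) ->
  0 < b <= 1 -> (forall t i j, 0 < A t i j -> b <= A t i j) ->
  directed_infinite_flow A ->
  (\sum_(1 <= q <oo) (b ^+ flow_gap A q)%:E = +oo)%E ->
  (fun t : nat => `|push_sum_z A x0 t i - average x0|) @ \oo --> (0 : R).
Proof.
move=> hA dA /andP[b0 b1] hb hflow hdiv.
set a := average x0.
set y := trajectory A (const_mx 1).
set u := trajectory A (x0 - a *: const_mx 1).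
have y_gt0 t j : 0 < y t j 0.
  by apply: trajectory_gt0 => // l; rewrite mxE ltr01.
have u_sum t : \sum_j u t j 0 = 0.
  rewrite sum_trajectory //; under eq_bigr do rewrite !mxE mulr1.
  rewrite big_split /= sumr_const card_ord -mulr_natl mulrN /a /average mulVKf.
    by rewrite subrr.
  by rewrite pnatr_eq0 -lt0n (leq_ltn_trans _ (ltn_ord i)).
pose c q := b ^+ flow_gap A q.
have c01 q : 0 <= c q <= 1 by rewrite /c exprn_ge0 ?exprn_ile1 ?(ltW b0).
pose E := \sum_j `|u 0%N j 0|.
have E0 : 0 <= E by apply: sumr_ge0.
pose e N := E * \prod_(1 <= p < N.+1) (1 - c p).
have e0 N : 0 <= e N.
  by rewrite mulr_ge0 // prodr_ge0 // => p _; have /andP[] := c01 p; lra.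
have contract N j : `|u (flow_time A (N * n)) j 0| <=
    e N * y (flow_time A (N * n)) j 0.
  elim: N j => [|N IH] j.
    have y0 : y 0%N j 0 = 1 by rewrite /y /= mxE.
    rewrite mul0n /e big_geq // y0 !mulr1 /E (bigD1 j) //=.
    by rewrite lerDl sumr_ge0.
  pose k := (flow_time A (N * n + n) - flow_time A (N * n))%N.
  have Tk : flow_time A (N.+1 * n) = (flow_time A (N * n) + k)%N.
    by rewrite mulSn addnC subnKC // flow_time_le // leq_addr.
  have ck : c N.+1 = b ^+ k by rewrite /c /flow_gap /k /= mulSn addnC.
  have -> : e N.+1 = (1 - c N.+1) * e N.
    by rewrite /e big_nat_recr //= mulrA mulrC.
  rewrite Tk /u /y !trajectory_transition -/u -/y.
  apply: column_stochastic_deviation => //.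
  - exact: column_stochastic_transition.
  - by have /andP[] := c01 N.+1.
  - by move=> l m; rewrite ck; apply: transition_flow_ge => //; exact: ltW.
  - by move=> l; exact: ltW.
(* Once reached, the bound [e N] persists: the case [c = 0] of the deviation lemma. *)
have bound N t : (flow_time A (N * n) <= t)%N ->
    `|push_sum_z A x0 t i - a| <= e N.
  move=> Nt; have -> : push_sum_z A x0 t i - a = u t i 0 / y t i 0.
    rewrite /push_sum_z /push_sum_x /push_sum_y -/(y t) /u trajectory_lin.
    by rewrite !mxE -/(y t) mulrBl mulfK ?gt_eqF.
  rewrite normrM normfV (gtr0_norm (y_gt0 _ _)) ler_pdivrMr //.
  rewrite -(subnKC Nt) /u /y !trajectory_transition -/u -/y.
  have M := column_stochastic_transition (flow_time A (N * n))
    (t - flow_time A (N * n)) hA.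
  have := column_stochastic_deviation M (lexx 0) M.1 (e0 N)
    (fun j => ltW (y_gt0 _ j)) (u_sum _) (contract N) i.
  by rewrite subr0 mul1r.
apply/cvgr0Pnorm_lt => eps eps0.
have c_ge0 q : 0 <= c q by have /andP[] := c01 q.
have [N hN] := nneseries_pinfty_gt c_ge0 hdiv (E / eps).
(* [N] may be 0, while [e N] is a product over [1 <= p < N.+1]: the sum is
   extended to the same range. *)
have hN' : E / eps < \sum_(1 <= p < N.+1) c p.
  apply: (lt_le_trans hN); case: N {hN} => [|N].
    by rewrite big_geq // sumr_ge0.
  by rewrite [X in _ <= X]big_nat_recr //= lerDl.
have eN : e N < eps.
  have := prod_1B_mul_1D_sum_le1 1 N.+1 c01.
  rewrite /e; set p := \prod_(_ <= _ < _) _; set S := \sum_(_ <= _ < _) _ in hN' *.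
  move=> pS.
  have p0 : 0 <= p.
    by rewrite prodr_ge0 // => q _; have /andP[] := c01 q; lra.
  move: hN'; rewrite ltr_pdivrMr // => ES.
  have [-> | pn0] := eqVneq p 0; first by rewrite mulr0.
  have ppos : 0 < p by rewrite lt_def pn0.
  have : E * p < S * eps * p by rewrite ltr_pM2r.
  by nra.
near=> t; rewrite normr_id; apply: (le_lt_trans _ eN); apply: bound.
by near: t; exact: nbhs_infty_ge.
Unshelve. all: by end_near.
Qed.

(** * Push-sum matrices *)

Lemma outdeg_gt0 {n : nat} {g : rel 'I_n} j : g j j -> (0 < outdeg g j)%N.
Proof. by move=> gj; apply/card_gt0P; exists j; rewrite inE. Qed.

Lemma push_sum_matrix_column_stochastic (R : realType) {n : nat}
    {g : rel 'I_n} :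
  (forall i, g i i) -> column_stochastic (push_sum_matrix R g).
Proof.
move=> gl; split=> [i j|j]; first by rewrite mxE; case: ifP.
under eq_bigr do rewrite mxE.
have -> : \sum_(i < n) (if g j i then (outdeg g j)%:R^-1 else 0) =
    (outdeg g j)%:R^-1 *+ outdeg g j :> R.
  by rewrite -big_mkcond /= sumr_const /outdeg cardsE.
by rewrite -[LHS]mulr_natr mulVf // pnatr_eq0 -lt0n outdeg_gt0.
Qed.

Lemma push_sum_matrix_ge {R : realType} {n : nat} {g : rel 'I_n} i j :
  0 < push_sum_matrix R g i j -> n%:R^-1 <= push_sum_matrix R g i j.
Proof.
rewrite mxE; case: ifP => [gji _|]; last by rewrite ltxx.
have d0 : (0 < outdeg g j)%N by apply/card_gt0P; exists i; rewrite inE.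
rewrite lef_pV2 ?posrE ?ltr0n //; last by rewrite (leq_ltn_trans _ (ltn_ord i)).
by rewrite ler_nat -[X in (_ <= X)%N]card_ord max_card.
Qed.

Theorem proposition4 (R : realType) (d : measure_display) (T : measurableType d)
    (P : probability T R) (n : nat) (hn : (2 <= n)%N)
    (G : nat -> T -> rel 'I_n)
    (hG : forall t : nat, random_digraph (G t))
    (hloop : forall (t : nat) (w : T) (i : 'I_n), G t w i i)
    (x0 : 'cV[R]_n) :
  let W : T -> nat -> 'M[R]_n := fun w t => push_sum_matrix R (G t w) in
  {ae P, forall w, directed_infinite_flow (W w)} ->
  {ae P, forall w,
    (\sum_(1 <= q <oo) (((n%:R : R) ^+ flow_gap (W w) q)^-1)%:E = +oo)%E} ->
  (exists delta : R, 0 < delta /\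
    {ae P, forall w, forall t : nat, exists t' : nat, (t <= t')%N /\
      forall i : 'I_n, delta <= push_sum_y (W w) t' i}) ->
  forall i : 'I_n,
    {ae P, forall w,
      (fun t : nat => `|push_sum_z (W w) x0 t.+1 i - average x0|) @ \oo --> (0 : R)}.
Proof.
move=> W hflow hdiv _ i; apply: filterS2 hflow hdiv => w hflow hdiv.
have n0 : (0 < n)%N := ltnW hn.
rewrite (cvg_shiftS (fun t => `|push_sum_z (W w) x0 t i - average x0|)).
apply: (@push_sum_consensus _ _ _ n%:R^-1) => //.
- by move=> t; apply: push_sum_matrix_column_stochastic.
- by move=> t j; rewrite mxE hloop invr_gt0 ltr0n outdeg_gt0.
- by rewrite invr_gt0 ltr0n n0 /= invf_le1 ?ltr0n ?ler1n.
- by move=> t j k; apply: push_sum_matrix_ge.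
- by rewrite -hdiv; apply: eq_eseriesr => q _; rewrite exprVn.
Qed.
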